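(* Let $e \geqslant 3$ be an integer. Then there exists $N$ such that for all integers $n > N$, \[ |\mathcal C_e(\mathsf T_n)| = \begin{cases} 2^{\lfloor\frac{e-1}{2}\rfloor\lfloor\frac{e-2}{2}\rfloor}, & \text{if $n$ is even},\\ 2^{\lfloor\frac{e-2}{2}\rfloor\lfloor\frac{e-3}{2}\rfloor}, & \text{if $n$ is odd}. \end{cases} \]
   Context: For $a\in\mathbb Z$ and a positive integer $e$, $\overline{a}^{(e)}$ denotes the residue class of $a$ modulo $2^e$. $\mathsf T_n$ is the set of $n\times n$ matrices $M$ with all entries in $\{1,-1\}$, all diagonal entries equal to $1$, and $(M-I)^{\top}=-(M-I)$. For a set $\mathsf M_n$ of $n\times n$ integer matrices, $\mathcal C_e(\mathsf M_n)$ is the set of tuples $\left(\overline{a_2}^{(e)},\dots,\overline{a_e}^{(e)}\right)$ such that $\det(xI-M)=\sum_{i=0}^n a_i x^{n-i}$ for some $M\in\mathsf M_n$ (with $a_i:=0$ for $i>n$). *)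

(* Defs.v *)
From mathcomp Require Import all_boot all_order all_algebra.
From mathcomp Require Import boolp.
Set Implicit Arguments.
Unset Strict Implicit.
Unset Printing Implicit Defensive.
Import GRing.Theory.
Local Open Scope ring_scope.

Definition skew_tournament_mx (n : nat) (M : 'M[int]_n) : Prop :=
  [/\ forall i j, M i j = 1 \/ M i j = -1,
      forall i, M i i = 1
    & (M - 1%:M)^T = - (M - 1%:M)].

(* det(xI - M) = \sum_i a_i x^(n-i); the test is needed because the
   subtraction on nat is truncated. *)
Definition char_coef (n : nat) (M : 'M[int]_n) (i : nat) : int :=
  if (i <= n)%N then (char_poly M)`_(n - i) else 0.

(* Entry k of the tuple is the class of a_(k+2), for k = 0, ..., e-2. *)
Definition char_coef_classes (e n : nat) (M : 'M[int]_n) :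
    (e.-1).-tuple 'Z_(2 ^ e) :=
  [tuple (char_coef M k.+2)%:~R | k < e.-1].

Definition congruence_classes (e n : nat) (Mn : 'M[int]_n -> Prop) :
    {set (e.-1).-tuple 'Z_(2 ^ e)} :=
  [set t | `[< exists M : 'M[int]_n, Mn M /\ char_coef_classes e M = t >]].

(* Main.v *)
Require Import Defs.
From mathcomp Require Import all_boot all_order all_algebra.
From mathcomp Require Import fingroup perm boolp ring zify.

(** Write [M = J - 2 B] with [B] the 0/1 adjacency matrix of a tournament, so that
    [B + B^T = J - I].  Since [det (A + s J)] is affine in [s], the coefficient
    [a_i] equals [2 ^ (i - 1) z_i], where [z_i] are the coefficients of
    [p(x) + (-1)^n p(1 - x)] and [p(x) = det (x I + B)].  The classes are thus
    governed by the [z_i] modulo [2 ^ (e + 1 - i)].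

    Every series [1 + O(u^3)] occurs as [det (I + u B)] modulo [2 ^ e] and
    [u ^ (e + 1)], for all large [n].  Joining tournaments multiplies these series,
    so those that occur form a subgroup of a finite group, and it contains
    [F_m = 1 + u^2 (1 - (1 - u)^m)], coming from a transitive tournament inserted
    in a 3-cycle.  The [r]-th multiplicative difference in [m] of the [F_m] is
    [1 +- u^(r+2) + ...], and such elements generate.

    It remains to count the [z]'s coming from all series [1 + O(u^3)].  The symmetry
    [x -> 1 - x] expresses [2 z_i], for odd [i], by the [z_j] with [j < i], so only
    even indices matter.  For even [n] the values [z_4, z_6, ...] are arbitrary; for
    odd [n] the same relations fix their parities and nothing else. *)

Set Implicit Arguments.
Unset Strict Implicit.
Unset Printing Implicit Defensive.
Import GRing.Theory Num.Theory Order.TTheory.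

(** * Generating the one-units 1 + O(u^3) *)

Section OneUnits.
Local Open Scope ring_scope.
Variables (R : comNzRingType) (u : R).

Lemma expr1D_quad (x : R) m : exists y, (1 + x) ^+ m = 1 + m%:R * x + x ^+ 2 * y.
Proof.
elim: m => [|m [y IH]]; first by exists 0; rewrite expr0 mul0r mulr0 !addr0.
exists (y + m%:R + x * y); rewrite exprS IH -natr1; ring.
Qed.

Variables (P K : nat).
Hypothesis P_gt0 : (0 < P)%N.
Hypothesis P_eq0 : P%:R = 0 :> R.

(** Since [P] vanishes in [R], the [P]-th power of 1 + z is 1 + O(z^2), which gains a factor [u]
    each time. Hence the power [P ^ K - 1] inverts 1 + u x modulo u^K, and the monoid [H] below can
    be used like a group. *)
Lemma one_unit_torsion k x : (0 < k)%N ->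
  exists y, (1 + u * x) ^+ (P ^ k) = 1 + u ^+ k * y.
Proof.
case: k => // k _; elim: k => [|k [y IH]].
  have [y ->] := expr1D_quad (u * x) (P ^ 1).
  exists (u * x ^+ 2 * y); rewrite expn1 P_eq0; ring.
rewrite expnSr exprM IH; have [z ->] := expr1D_quad (u ^+ k.+1 * y) P.
exists (u ^+ k * y ^+ 2 * z); rewrite P_eq0 !exprS; ring.
Qed.

(** Coefficientwise the left side is ((1 - u)^(j+1) - 1) f_j, a multiple of u, and for j = 0 it is -
    u f_0. *)
Lemma horner_dilate_sub (f : {poly R}) : exists g : {poly R},
  (forall p : R, (1 - u) * f.[(1 - u) * p] - f.[p] = u * g.[p]) /\ g.[0] = - f.[0].
Proof.
elim/poly_ind: f => [|f c [g [Hg g0]]].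
  by exists 0; split=> [p|]; rewrite !horner0; ring.
exists (('X) * ((1 - u) *: g - f) + (- c)%:P); split=> [p|].
  rewrite !hornerMXaddC !hornerE /=; move: (Hg p) => /eqP; rewrite subr_eq => /eqP E.
  transitivity ((1 - u) * p * ((1 - u) * f.[(1 - u) * p]) + (1 - u) * c
                - (f.[p] * p + c)); first ring.
  rewrite E; ring.
by rewrite !hornerE; ring.
Qed.

Variable H : R -> Prop.
Hypothesis H1 : H 1.
Hypothesis HM : forall f g, H f -> H g -> H (f * g).
Hypothesis HK : forall f g, H f -> H (f + u ^+ K * g).
Hypothesis HF : forall m, H (1 + u ^+ 2 * (1 - (1 - u) ^+ m)).
Hypothesis decomp : forall r : R, exists c : nat, exists s, r = c%:R + u * s.
Hypothesis K_gt0 : (0 < K)%N.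

Lemma monoidX f m : H f -> H (f ^+ m).
Proof. by move=> Hf; elim: m => [|m IH]; rewrite ?expr0 ?exprS //; apply: HM. Qed.

(* The points [p m := u ^+ 2 * (1 - u) ^+ m] satisfy [p m.+1 = (1 - u) * p m],
   so the quotient of consecutive members of a family polynomial in [p m] gains
   one factor [u]. *)
Lemma iterated_quotient r : exists psi : {poly R}, exists eps : R,
  [/\ eps = 1 \/ eps = -1, exists s, psi.[0] = eps + u * s &
   forall m, let p := u ^+ 2 * (1 - u) ^+ m in H (1 + u ^+ r.+1 * p * psi.[p])].
Proof.
have P1 : (0 < P ^ K)%N by rewrite expn_gt0 P_gt0.
elim: r => [|r [psi [eps [Heps [s psi0] Hpsi]]]].
  (* With F_m = 1 + u^2 - p, the quotient F_(m+1) / F_m is 1 + u p / F_m; this power stands for 1 /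
     F_m modulo u^K. *)
  exists (((1 + u ^+ 2)%:P - 'X) ^+ (P ^ K).-1); exists 1; split; first by left.
    have [y Ey] := expr1D_quad (u ^+ 2) (P ^ K).-1.
    exists (u * (P ^ K).-1%:R + u ^+ 3 * y).
    rewrite horner_exp !hornerE /= ?subr0.
    by rewrite Ey; ring.
  move=> m p; rewrite horner_exp.
  have -> : ((1 + u ^+ 2)%:P - 'X).[p] = 1 + u ^+ 2 - p by rewrite !hornerE.
  have Ep : 1 + u ^+ 2 * (1 - (1 - u) ^+ m) = 1 + u ^+ 2 - p by rewrite /p; ring.
  have [y Ey] := one_unit_torsion (u - u * (1 - u) ^+ m) K_gt0.
  have {}Ey : (1 + u ^+ 2 - p) ^+ (P ^ K) = 1 + u ^+ K * y.
    by rewrite -Ey; congr (_ ^+ _); rewrite /p; ring.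
  have := HK (- y) (HM (HF m.+1) (monoidX (P ^ K).-1 (HF m))).
  congr H; rewrite Ep; set v := (_ ^+ (P ^ K).-1).
  have Ev : (1 + u ^+ 2 - p) * v = 1 + u ^+ K * y by rewrite -Ey -exprS prednK.
  have -> : 1 + u ^+ 2 * (1 - (1 - u) ^+ m.+1) = (1 + u ^+ 2 - p) + u * p.
    by rewrite /p [(1 - u) ^+ m.+1]exprS; ring.
  by rewrite mulrDl Ev; ring.
(* If w_m = h(p) is the current family, then w_(m+1) / w_m = 1 + u^(r+2) p g(p) / w_m, the division
   again being a power. *)
have [g [Hg g0]] := horner_dilate_sub psi.
pose h := 1 + (u ^+ r.+1)%:P * 'X * psi.
exists (g * h ^+ (P ^ K).-1); exists (- eps); split.
- by case: Heps => ->; [right | left; rewrite opprK].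
- exists (- s); rewrite hornerM horner_exp /h !hornerE /= expr1n g0 psi0; ring.
move=> m p; have Hp := Hpsi m; have HSp := Hpsi m.+1.
rewrite /= -/p in Hp.
have ESp : u ^+ 2 * (1 - u) ^+ m.+1 = (1 - u) * p.
  by rewrite /p [(1 - u) ^+ m.+1]exprS; ring.
rewrite /= ESp in HSp.
rewrite hornerM horner_exp.
have -> : h.[p] = 1 + u ^+ r.+1 * p * psi.[p] by rewrite /h !hornerE.
have [y Ey] := one_unit_torsion (u ^+ r * p * psi.[p]) K_gt0.
rewrite 2!(mulrA u) -exprS in Ey.
have := HK (- y) (HM HSp (monoidX (P ^ K).-1 Hp)).
set w := (1 + u ^+ r.+1 * p * psi.[p]) in Ey *; set v := w ^+ (P ^ K).-1.
have Ev : w * v = 1 + u ^+ K * y by rewrite -Ey -exprS prednK.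
congr H.
have -> : 1 + u ^+ r.+1 * ((1 - u) * p) * psi.[(1 - u) * p]
   = w + u ^+ r.+1 * p * ((1 - u) * psi.[(1 - u) * p] - psi.[p]).
  by rewrite /w; ring.
by rewrite Hg mulrDl Ev [u ^+ r.+2]exprS; ring.
Qed.

(** Downward induction on the exponent of u, starting where [HK] suffices. Each level needs one
    element of [H] with leading coefficient 1 or -1, supplied by [iterated_quotient]. *)
Lemma one_units_generated g : H (1 + u ^+ 3 * g).
Proof.
have P1 : (0 < P ^ K)%N by rewrite expn_gt0 P_gt0.
suff Hk k d : (K <= k + d)%N -> forall g, H (1 + u ^+ k.+3 * g).
  by apply: (Hk 0%N K); rewrite add0n.
elim: d k => [|d IH] k Kle {}g.
  rewrite addn0 in Kle.
  have -> : u ^+ k.+3 * g = u ^+ K * (u ^+ (k.+3 - K) * g).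
    by rewrite mulrA -exprD subnKC // (leq_trans Kle) // ltnW // ltnW.
  exact: HK.
have {}IH := IH k.+1; rewrite addSnnS in IH; have {}IH := IH Kle.
have [psi [eps [Heps [s psi0] Hpsi]]] := iterated_quotient k.
have {}Hpsi := Hpsi 0%N; rewrite /= expr0 mulr1 -exprD addn2 in Hpsi.
(* At m = 0 the point p is u^2, a multiple of u, so psi still takes the value eps modulo u. *)
have [t Et] : exists t, psi.[u ^+ 2] = eps + u * t.
  elim/poly_ind: psi psi0 {Hpsi} => [|f c _].
    by rewrite !horner0; exists s.
  by rewrite !hornerMXaddC mulr0 add0r => ->; exists (s + u * f.[u ^+ 2]); ring.
rewrite Et in Hpsi.
(* [h] and [h'] are inverse modulo u^K; the sign [eps] decides which of them is the given
   element. *)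
have [h [h' [x [x' [y [Hh Eh Eh' Ehh']]]]]] : exists h h' x x' y, [/\ H h,
    h = 1 + u ^+ k.+3 * (1 + u * x), h' = 1 + u ^+ k.+3 * (-1 + u * x') &
    h * h' = 1 + u ^+ K * y].
  have [y Ey] := one_unit_torsion (u ^+ k.+2 * (eps + u * t)) K_gt0.
  rewrite mulrA -exprS in Ey.
  set w := 1 + _ in Ey Hpsi.
  have [x Ex] : exists x, w ^+ (P ^ K).-1 = 1 + u ^+ k.+3 * (- eps + u * x).
    have [z Ez] := expr1D_quad (u ^+ k.+3 * (eps + u * t)) (P ^ K).-1.
    exists (- t + u ^+ k.+2 * (eps + u * t) ^+ 2 * z).
    have E0 : (P ^ K).-1%:R = -1 :> R.
      have := natrX R P K; rewrite P_eq0 expr0n (gtn_eqF K_gt0) -(prednK P1) -natr1.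
      by move=> /eqP; rewrite addr_eq0 => /eqP.
    by rewrite Ez E0 [u ^+ k.+3]exprS; ring.
  case: Heps => Heps; rewrite {}Heps in w Ex Ey Hpsi *.
    exists w, (w ^+ (P ^ K).-1), t, x, y; split=> //.
    by rewrite -exprS prednK.
  exists (w ^+ (P ^ K).-1), w, x, t, y; split=> //; first exact: monoidX.
    by rewrite Ex opprK.
  by rewrite -exprSr prednK.
(* As g = c modulo u, the product (1 + u^(k+3) g) h'^c is 1 + O(u^(k+4)), so [IH] puts it in [H];
   the long argument below is its explicit cofactor. Multiplying by h^c then restores 1 + u^(k+3) g
   modulo u^K. *)
have [c [r Er]] := decomp g.
have [z Ez] := expr1D_quad (u ^+ k.+3 * (-1 + u * x')) c.
have [z' Ez'] := expr1D_quad (u ^+ K * y) c.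
have Hc := HM (monoidX c Hh) (IH (r + c%:R * x' + u ^+ k.+2 * (-1 + u * x') ^+ 2 * z
   + u ^+ k.+2 * g * (c%:R * (-1 + u * x') + u ^+ k.+3 * (-1 + u * x') ^+ 2 * z))).
have {Hc} := HK (- (1 + u ^+ k.+3 * g) * (c%:R * y + u ^+ K * y ^+ 2 * z')) Hc.
congr H.
have -> : 1 + u ^+ k.+4 * (r + c%:R * x' + u ^+ k.+2 * (-1 + u * x') ^+ 2 * z
   + u ^+ k.+2 * g * (c%:R * (-1 + u * x') + u ^+ k.+3 * (-1 + u * x') ^+ 2 * z))
  = (1 + u ^+ k.+3 * g) * h' ^+ c.
  by rewrite Eh' Ez Er [u ^+ k.+4]exprS [u ^+ k.+3]exprS; ring.
rewrite mulrCA -exprMn Ehh' Ez'; ring.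
Qed.
End OneUnits.

(** * Rank-one updates of determinants *)

Section Determinants.
Local Open Scope ring_scope.
Variable R : comNzRingType.

Lemma det_block_schur n (r : 'rV[R]_n) (c : 'cV[R]_n) (D : 'M[R]_n) :
  \det (block_mx 1%:M r c D) = \det (D - c *m r).
Proof.
have -> : block_mx 1%:M r c D = block_mx 1%:M 0 c 1%:M *m block_mx 1%:M r 0 (D - c *m r).
  by rewrite mulmx_block !mul1mx !mulmx1 !mul0mx !addr0 addrCA subrr addr0.
by rewrite det_mulmx det_lblock det_ublock !det1 !mul1r.
Qed.

(** A Schur complement turns the rank-one term into a border with first row (1, -s, ..., -s), and
    the determinant is linear in that row. *)
Lemma det_addJ_affine n (D : 'M[R]_n) :
  exists b, forall s, \det (D + s *: const_mx 1) = \det D + s * b.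
Proof.
exists (\det (block_mx (0 : 'M_1) (- const_mx 1) (const_mx 1) D)) => s.
have -> : D + s *: const_mx 1 = D - const_mx 1 *m (- (s *: const_mx 1) : 'rV_n).
  apply/matrixP => i j; rewrite !mxE big_ord1 !mxE; ring.
rewrite -det_block_schur.
have -> : \det D = \det (block_mx (1%:M : 'M_1) (0 : 'rV_n) (const_mx 1) D).
  by rewrite det_lblock det1 mul1r.
rewrite -[X in X + _]mul1r.
apply: (determinant_multilinear (i0 := lshift n (0 : 'I_1))).
- rewrite !block_mxEv !rowKu scale1r; apply/rowP => j; rewrite !mxE.
  by case: split => k; rewrite !mxE; ring.
- by apply/matrixP => i j; rewrite !block_mxEv !row'Ku !mxE; case: split => k //; case: k.
- by apply/matrixP => i j; rewrite !block_mxEv !row'Ku !mxE; case: split => k //; case: k.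
Qed.

End Determinants.

(** * Tournaments and det (I + X B) *)

Section Tournaments.
Local Open Scope ring_scope.

Definition tournament_mx n (B : 'M[int]_n) : Prop :=
  (forall i j, B i j = 0 \/ B i j = 1) /\ B + B^T = const_mx 1 - 1%:M.

(** For a tournament, the coefficient of X^i is a signed count of the families of disjoint directed
    cycles covering i vertices. *)
Definition cycle_poly n (B : 'M[int]_n) : {poly int} :=
  \det (1%:M + 'X *: map_mx polyC B).

Definition join_mx m n (A : 'M[int]_m) (B : 'M[int]_n) : 'M[int]_(m + n) :=
  block_mx A (const_mx 1) 0 B.

(* Two new vertices [a] and [b] and the arcs [b -> a], [a -> i] and [i -> b]
   for every vertex [i] of [B]. *)
Definition cone_mx n (B : 'M[int]_n) : 'M[int]_(1 + (1 + n)) :=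
  block_mx 0 (row_mx 0 (const_mx 1)) (col_mx 1%:M 0)
    (block_mx 0 0 (const_mx 1) B).

Definition transitive_mx n : 'M[int]_n := \matrix_(i, j) ((i < j)%N%:R).

Lemma const_mx_block (R : Type) m n p q (a : R) :
  const_mx a = block_mx (const_mx a : 'M_(m, p)) (const_mx a : 'M_(m, q))
                        (const_mx a : 'M_(n, p)) (const_mx a : 'M_(n, q)).
Proof. by rewrite block_mxEh !col_mx_const row_mx_const. Qed.

Lemma block_mx_01 m n p q (A : 'M[int]_(m, p)) (B : 'M[int]_(m, q))
    (C : 'M[int]_(n, p)) (D : 'M[int]_(n, q)) :
  (forall i j, A i j = 0 \/ A i j = 1) -> (forall i j, B i j = 0 \/ B i j = 1) ->
  (forall i j, C i j = 0 \/ C i j = 1) -> (forall i j, D i j = 0 \/ D i j = 1) ->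
  forall i j, block_mx A B C D i j = 0 \/ block_mx A B C D i j = 1.
Proof.
by move=> hA hB hC hD i j; rewrite !mxE; case: split => k; rewrite mxE; case: split.
Qed.

Lemma tournament_join m n (A : 'M[int]_m) (B : 'M[int]_n) :
  tournament_mx A -> tournament_mx B -> tournament_mx (join_mx A B).
Proof.
move=> [hA eA] [hB eB]; split.
  by apply: block_mx_01 => // i j; rewrite mxE; [right | left].
rewrite tr_block_mx add_block_mx eA eB trmx0 trmx_const addr0 add0r.
rewrite (const_mx_block m n m n) (scalar_mx_block m n).
by rewrite opp_block_mx add_block_mx !subr0.
Qed.

Lemma tournament_cone n (B : 'M[int]_n) :
  tournament_mx B -> tournament_mx (cone_mx B).
Proof.
move=> [hB eB]; split.
  apply: block_mx_01 => [i j|i j|i j|].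
  - by left; rewrite mxE.
  - by rewrite mxE; case: split => k; rewrite mxE; [left|right].
  - rewrite mxE; case: split => k; rewrite mxE; last by left.
    by case: eqP; [right|left].
  apply: block_mx_01 => // i j; rewrite mxE; by [left | right].
rewrite /cone_mx !tr_block_mx tr_row_mx tr_col_mx !trmx0 !trmx_const trmx1.
rewrite !add_block_mx eB add_row_mx add_col_mx !addr0 !add0r.
rewrite (const_mx_block 1 (1 + n) 1 (1 + n)) (scalar_mx_block 1 (1 + n)).
rewrite opp_block_mx add_block_mx !subr0.
rewrite (const_mx_block 1 n 1 n) (scalar_mx_block 1 n) opp_block_mx add_block_mx !subr0.
have E1 : const_mx 1 = 1%:M :> 'M[int]_1.
  by apply/matrixP => i j; rewrite !mxE !ord1.
rewrite -row_mx_const -col_mx_const -E1 !subrr.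
by [].
Qed.

Lemma tournament_transitive n : tournament_mx (transitive_mx n).
Proof.
split=> [i j|]; first by rewrite mxE; case: (i < j)%N; [right|left].
by apply/matrixP => i j; rewrite !mxE -val_eqE /=; case: ltngtP.
Qed.

Lemma cycle_poly_transitive n : cycle_poly (transitive_mx n) = 1.
Proof.
rewrite /cycle_poly -det_tr det_trig; last first.
  apply/is_trig_mxP => i j lij; rewrite !mxE -val_eqE /= (gtn_eqF lij) ltnNge.
  by rewrite (ltnW lij) polyC0 mulr0 addr0.
by apply: big1 => i _; rewrite !mxE eqxx ltnn polyC0 mulr0 addr0.
Qed.

Lemma cycle_poly_join m n (A : 'M[int]_m) (B : 'M[int]_n) :
  cycle_poly (join_mx A B) = cycle_poly A * cycle_poly B.
Proof.
rewrite /cycle_poly /join_mx map_block_mx map_mx0 scale_block_mx scaler0.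
by rewrite (scalar_mx_block m n) add_block_mx !add0r det_ublock.
Qed.

(** Two Schur complements eliminate [a] and [b]. The path i -> b -> a -> j exists for every pair (i,
    j) and has weight X^3, whence the multiple of the all-ones matrix. *)
Lemma cycle_poly_cone n (B : 'M[int]_n) :
  cycle_poly (cone_mx B) = \det (1%:M + 'X *: map_mx polyC B + 'X^3 *: const_mx 1).
Proof.
rewrite /cycle_poly /cone_mx !map_block_mx map_row_mx map_col_mx !map_mx0 !map_const_mx.
rewrite map_mx1 !scale_block_mx scale_row_mx scale_col_mx !scaler0 polyC1.
rewrite (scalar_mx_block 1 (1 + n)) add_block_mx !add0r addr0 det_block_schur.
rewrite mul_col_row !mulmx0 !mul0mx (scalar_mx_block 1 n) add_block_mx !addr0 !add0r.
rewrite opp_block_mx add_block_mx !subr0 add0r det_block_schur; congr (\det _).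
apply/matrixP => i j; rewrite !mxE !big_ord1 !mxE !big_ord1 !mxE /=.
by rewrite !mulr1; ring.
Qed.

Lemma cycle_poly_cone_transitive n :
  cycle_poly (cone_mx (transitive_mx n)) = 1 + 'X^2 * (1 - (1 - 'X) ^+ n).
Proof.
rewrite cycle_poly_cone.
have [b Hb] := det_addJ_affine (1%:M + 'X *: map_mx polyC (transitive_mx n)).
rewrite Hb -/(cycle_poly _) cycle_poly_transitive.
(* At s = -X the entries above the diagonal vanish and the diagonal entries are 1 - X. So 1 - X b =
   (1 - X)^n, which gives X^3 b. *)
have := Hb (- 'X); rewrite -/(cycle_poly _) cycle_poly_transitive det_trig; last first.
  apply/is_trig_mxP => i j lij; rewrite !mxE -val_eqE /= (ltn_eqF lij) lij.
  by rewrite polyC1 !mulr1 add0r subrr.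
under eq_bigr => i _ do rewrite !mxE eqxx ltnn polyC0 mulr0 addr0 mulr1.
rewrite prodr_const card_ord => ->; ring.
Qed.

End Tournaments.

(** * Coefficients of [cycle_poly] *)

Section CyclePoly.
Local Open Scope ring_scope.

Lemma tournament_diag n (B : 'M[int]_n) i : tournament_mx B -> B i i = 0.
Proof.
move=> [_ /matrixP/(_ i i)]; rewrite !mxE eqxx subrr -mulr2n => /eqP.
by rewrite mulrn_eq0 /= => /eqP.
Qed.

Lemma tournament_mul_sym n (B : 'M[int]_n) i j : tournament_mx B -> B i j * B j i = 0.
Proof.
move=> [hB /matrixP/(_ i j)]; rewrite !mxE.
by case: (hB i j) => ->; case: (hB j i) => ->; rewrite ?mul0r ?mulr0 //; case: eqP.
Qed.

(* In the Leibniz expansion a transposition contributes [B i j * B j i = 0] and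
   every other nontrivial permutation moves at least three points. *)
Lemma cycle_poly_low n (B : 'M[int]_n) : tournament_mx B ->
  exists g, cycle_poly B = 1 + 'X^3 * g.
Proof.
move=> tB; rewrite /cycle_poly /determinant (bigD1 (1%g : {perm _})) //=.
rewrite odd_perm1 expr0 mul1r big1; last first.
  by move=> i _; rewrite !mxE perm1 eqxx tournament_diag // polyC0 mulr0 addr0.
suff [g ->] : exists g, \sum_(s : 'S_n | s != 1%g)
    (-1) ^+ s * \prod_i (1%:M + 'X *: map_mx polyC B) i (s i) = 'X^3 * g by exists g.
elim/big_ind: _ => [|f1 f2 [g1 ->] [g2 ->]|s s1].
- by exists 0; rewrite mulr0.
- by exists (g1 + g2); rewrite mulrDr.
have [i si] : exists i, s i != i.
  apply/existsP; apply: contraNT s1; rewrite negb_exists => /forallP sid.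
  by apply/eqP/permP => i; rewrite perm1; apply/eqP; rewrite -[_ == _]negbK.
rewrite (bigD1 i) //= (bigD1 (s i)) //= !mxE [i == s i]eq_sym (negPf si).
rewrite [s i == s (s i)](inj_eq perm_inj) [i == s i]eq_sym (negPf si) !add0r.
have [ssi|ssi] := eqVneq (s (s i)) i.
  exists 0; rewrite ssi; set t := \prod_(_ | _) _; set sg := _ ^+ s.
  transitivity (sg * 'X * 'X * (B i (s i) * B (s i) i)%:P * t).
    by rewrite polyCM; move: sg t (_%:P) (_%:P) => *; ring.
  by rewrite tournament_mul_sym // polyC0 mulr0 mul0r mulr0.
rewrite (bigD1 (s (s i))) /=; last first.
  by rewrite ssi (inj_eq perm_inj) si.
rewrite !mxE (inj_eq perm_inj) [s i == _]eq_sym (inj_eq perm_inj) (negPf si) add0r.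
set t := \prod_(_ | _) _; set b1 := (B i _)%:P; set b2 := (B (s i) _)%:P.
set b3 := (B (s (s i)) _)%:P; set sg := _ ^+ s.
by exists (sg * b1 * b2 * b3 * t); move: sg b1 b2 b3 t => *; ring.
Qed.

Lemma horner_char_poly (R : comNzRingType) n (A : 'M[R]_n) c :
  (char_poly A).[c] = \det (c%:M - A).
Proof.
rewrite -[LHS]/(horner_eval c (char_poly A)) -det_map_mx; congr (\det _).
apply/matrixP => i j; rewrite !mxE /= /horner_eval.
by case: eqP => _; rewrite ?mulr1n ?mulr0n !hornerE.
Qed.

(** Over the fraction field, det (I + X B) = X^n det (X^-1 I + B), so the two polynomials are
    reversals of each other. *)
Lemma coef_cycle_poly n (B : 'M[int]_n) i : (i <= n)%N ->
  (cycle_poly B)`_i = (char_poly (- B))`_(n - i).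
Proof.
pose F := {fraction {poly int}}.
pose g : {rmorphism int -> F} :=
  [the {rmorphism int -> F} of @tofrac {poly int} \o polyC].
set p := char_poly _; pose x : F := tofrac 'X.
have x0 : x != 0 by rewrite tofrac_eq0 polyX_eq0.
suff -> : cycle_poly B = \sum_(j < n.+1) p`_j *: 'X^(n - j).
  move=> lin; have lt : (n - i < n.+1)%N by rewrite ltnS leq_subr.
  rewrite coef_sum (bigD1 (Ordinal lt)) //= coefZ coefXn subKn // eqxx mulr1.
  rewrite big1 ?addr0 // => j; rewrite -val_eqE /= => ji.
  rewrite coefZ coefXn; case: eqP => [E|]; last by rewrite mulr0.
  by case/eqP: ji; rewrite E subKn // -ltnS.
apply/eqP; rewrite -tofrac_eq; apply/eqP.
rewrite [RHS]rmorph_sum /= /cycle_poly.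
pose tf : {rmorphism {poly int} -> F} := @tofrac {poly int}.
rewrite -[X in X = _]/(tf _) -(det_map_mx tf).
have -> : map_mx tf (1%:M + 'X *: map_mx polyC B)
   = x *: (x^-1%:M - map_mx g (- B)).
  apply/matrixP => k l; rewrite !mxE /g !rmorphN opprK mulrDr rmorphD rmorphM /=.
  congr (_ + _); case: eqP => _;
    by rewrite ?mulr1n ?mulr0n ?rmorph1 ?rmorph0 ?mulr0 // divff.
rewrite detZ -horner_char_poly -map_char_poly (@horner_coef_wide _ n.+1); last first.
  by rewrite map_char_poly size_char_poly.
rewrite mulr_sumr; apply: eq_bigr => j _.
rewrite coef_map /= -mul_polyC rmorphM rmorphXn /= mulrCA; congr (_ * _).
by rewrite exprVn -/x expfB_cond // (negPf x0) add0n -ltnS.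
Qed.
End CyclePoly.

(** * Realizing every series 1 + O(X^3) *)

Section Realization.
Local Open Scope ring_scope.

Lemma intr_Zp_eq0 p (a : int) : (1 < p)%N -> ((a%:~R == 0 :> 'Z_p) = (p %| a)%Z).
Proof.
move=> p1.
have Hn m : ((m%:R == 0 :> 'Z_p) = (p %| m)%N).
  by rewrite -val_eqE /= val_Zp_nat.
by case: a => m; rewrite ?NegzE ?rmorphN ?oppr_eq0 ?rpredN /= Hn.
Qed.

Lemma intr_Zp_eq p (a b : int) : (1 < p)%N ->
  (a%:~R = b%:~R :> 'Z_p) <-> (p %| a - b)%Z.
Proof.
move=> p1; rewrite -intr_Zp_eq0 // rmorphB subr_eq0.
by split => [/eqP|/eqP].
Qed.

Variable e : nat.
Hypothesis e_gt0 : (0 < e)%N.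

Definition realized n (f : {poly 'Z_(2 ^ e)}) : Prop :=
  exists2 B : 'M[int]_n, tournament_mx B &
  exists g, map_poly intr (cycle_poly B) = f + 'X^(e.+1) * g.

Lemma realizedM m n f g : realized m f -> realized n g -> realized (m + n) (f * g).
Proof.
move=> [A tA [a Ea]] [B tB [b Eb]].
exists (join_mx A B); first exact: tournament_join.
exists (f * b + a * g + 'X^(e.+1) * a * b).
rewrite cycle_poly_join rmorphM /= Ea Eb; set x := 'X^_; move: x => x; ring.
Qed.

Lemma realized1 n : realized n 1.
Proof.
exists (transitive_mx n); first exact: tournament_transitive.
by exists 0; rewrite cycle_poly_transitive rmorph1 mulr0 addr0.
Qed.

(** Joining a transitive tournament adds vertices and multiplies [cycle_poly] by 1. *)
Lemma realized_widen m n f : (m <= n)%N -> realized m f -> realized n f.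
Proof.
move=> mn Hf; rewrite -(subnKC mn) -[f]mulr1.
by apply: realizedM Hf (realized1 _).
Qed.

Lemma realized_all g : exists n, realized n (1 + 'X^3 * g).
Proof.
have P1 : (1 < 2 ^ e)%N by rewrite -{1}(expn0 2) ltn_exp2l.
apply: (@one_units_generated {poly 'Z_(2 ^ e)} 'X (2 ^ e) e.+1 _ _
  (fun f => exists n, realized n f)) => //.
- by rewrite expn_gt0.
- by rewrite -polyC_natr pchar_Zp // polyC0.
- by exists 0%N; apply: realized1.
- by move=> f h [m Hf] [n Hh]; exists (m + n)%N; apply: realizedM.
- move=> f h [n [B tB [b Eb]]]; exists n, B => //; exists (b - h).
  by rewrite Eb -addrA -mulrDr subrKC.
- move=> m; exists (1 + (1 + m))%N, (cone_mx (transitive_mx m)).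
    exact/tournament_cone/tournament_transitive.
  exists 0; rewrite cycle_poly_cone_transitive mulr0 addr0.
  by rewrite rmorphD rmorphM rmorphB !rmorphXn rmorphB !rmorph1 /= map_polyX.
- elim/poly_ind => [|r c _]; first by exists 0%N, 0; rewrite mulr0 addr0.
  by exists c, r; rewrite -polyC_natr natr_Zp addrC mulrC.
Qed.

Lemma realization_bound : exists N : nat, forall n, (N < n)%N ->
  forall x : nat -> int, x 0%N = 1 -> x 1%N = 0 -> x 2%N = 0 ->
  exists2 B : 'M[int]_n, tournament_mx B &
  forall i, (i <= e)%N -> ((2 ^ e)%N %| (cycle_poly B)`_i - x i)%Z.
Proof.
have P1 : (1 < 2 ^ e)%N by rewrite -{1}(expn0 2) ltn_exp2l.
(* Only the residues of finitely many values of [x] matter, so finitely many polynomials [G t] have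
   to be realized and one bound serves all [x]. *)
pose G (t : {ffun 'I_e.+1 -> 'Z_(2 ^ e)}) := \poly_(i < e.+1) t (inord i).
have [N HN] := fin_all_exists (fun t => realized_all (G t)).
exists (\max_t N t) => n ltn x x0 x1 x2.
pose t := [ffun i : 'I_e.+1 => (x i.+3)%:~R : 'Z_(2 ^ e)].
have [|B tB [g Eg]] := @realized_widen _ n _ _ (HN t).
  by apply: leq_trans (ltnW ltn); apply: leq_bigmax.
exists B => // i ile; apply/(intr_Zp_eq (p := 2 ^ e)) => //.
have := congr1 (fun f : {poly _} => f`_i) Eg; rewrite coef_map /= => ->.
rewrite !coefD [('X^(e.+1) * g)`_i]coefXnM (ltnS i e) ile addr0 coefXnM coef1.
case: i ile => [|[|[|i]]] ile; rewrite ?x0 ?x1 ?x2 ?addr0 //=.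
rewrite add0r subSS subSS subSS subn0 coef_poly.
have li : (i < e.+1)%N by rewrite ltnS (leq_trans _ ile) // ltnW // ltnW.
by rewrite li ffunE inordK.
Qed.
End Realization.

(** * The reflection x -> 1 - x on coefficients *)

Section Reflection.
Local Open Scope ring_scope.
Variable n : nat.
Implicit Types (c : nat -> int) (i j k : nat).

(* [c] encodes the polynomial [\sum_j c j X^(n - j)] and [refl_coef c] its image
   [(-1)^n p(1 - X)]. *)
Definition desc_poly c : {poly int} := \sum_(j < n.+1) c j *: 'X^(n - j).

Definition refl_coef c i : int :=
  (-1) ^+ i * \sum_(j < i.+1) c j * 'C(n - j, i - j)%:R.

(** These are the z_i when [c] lists the coefficients of det (x I + B). *)
Definition sym_coef c i : int := c i + refl_coef c i.

Lemma coef_desc_poly c i : (i <= n)%N -> (desc_poly c)`_(n - i) = c i.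
Proof.
move=> lin; have lt : (i < n.+1)%N by [].
rewrite coef_sum (bigD1 (Ordinal lt)) //= coefZ coefXn eqxx mulr1.
rewrite big1 ?addr0 // => j; rewrite -val_eqE /= => ji.
rewrite coefZ coefXn; case: eqP => [E|]; last by rewrite mulr0.
by case/eqP: ji; have := ltn_ord j; lia.
Qed.

Lemma coef_desc_poly_ge c k : (n < k)%N -> (desc_poly c)`_k = 0.
Proof.
move=> nk; rewrite coef_sum big1 // => j _; rewrite coefZ coefXn.
by case: eqP => [E|]; rewrite ?mulr0 //; lia.
Qed.

Lemma desc_poly_eq c c' : (forall i, (i <= n)%N -> c i = c' i) ->
  desc_poly c = desc_poly c'.
Proof. by move=> E; apply: eq_bigr => j _; rewrite E // -ltnS. Qed.

Lemma desc_polyK (p : {poly int}) : (size p <= n.+1)%N ->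
  desc_poly (fun i => p`_(n - i)) = p.
Proof.
move=> sp; apply/polyP => k; have [kn|nk] := leqP k n.
  by rewrite -(subKn kn) coef_desc_poly ?leq_subr // subKn ?leq_subr.
by rewrite coef_desc_poly_ge // nth_default // (leq_trans sp).
Qed.

Lemma coef_1subX_exp m k : (((1 - 'X) ^+ m : {poly int}))`_k = (-1) ^+ k * 'C(m, k)%:R.
Proof.
elim: m k => [|m IH] k.
  by rewrite expr0 coef1 bin0n; case: k => [|k]; rewrite ?mulr1 ?mulr0.
rewrite exprSr mulrBr mulr1 coefB coefMX !IH; case: k => [|k] /=.
  by rewrite !bin0 subr0.
by rewrite binS natrD exprS; ring.
Qed.

Lemma desc_poly_refl c :
  desc_poly (refl_coef c) = (-1) ^+ n *: (desc_poly c \Po (1 - 'X)).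
Proof.
apply/polyP => k; rewrite coefZ.
have -> : (desc_poly c \Po (1 - 'X))`_k =
    \sum_(j < n.+1) (c j *: 'X^(n - j) \Po (1 - 'X))`_k.
  by rewrite /desc_poly raddf_sum coef_sum.
under eq_bigr => j _ do rewrite comp_polyZ coefZ comp_Xn_poly coef_1subX_exp.
have [kn|nk] := leqP k n; last first.
  rewrite coef_desc_poly_ge // big1 ?mulr0 // => j _.
  by rewrite bin_small ?mulr0 // (leq_ltn_trans (leq_subr _ _)).
have [i lin ->] : exists2 i, (i <= n)%N & k = (n - i)%N.
  by exists (n - k)%N; rewrite ?leq_subr // subKn.
rewrite coef_desc_poly // /refl_coef.
rewrite (big_ord_widen n.+1 (fun j => c j * 'C(n - j, i - j)%:R)) //.
rewrite big_mkcond !mulr_sumr; apply: eq_bigr => j _.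
have -> : (-1) ^+ i = (-1) ^+ n * (-1) ^+ (n - i) :> int.
  by rewrite -exprD -signr_odd -[RHS]signr_odd; congr (_ ^+ nat_of_bool _); lia.
case: ltnP => ji.
  have -> : (n - i = (n - j) - (i - j))%N by lia.
  by rewrite bin_sub ?leq_sub2r //; ring.
by rewrite [in RHS]bin_small ?mulr0 //; have := ltn_ord j; lia.
Qed.

(** The substitution x -> 1 - x is an involution and the sign (-1)^n squares to 1. *)
Lemma refl_coefK c i : (i <= n)%N -> refl_coef (refl_coef c) i = c i.
Proof.
move=> lin; rewrite -coef_desc_poly // !desc_poly_refl comp_polyZ scalerA.
rewrite -exprD addnn -mul2n exprM sqrrN !expr1n scale1r -comp_polyA.
by rewrite comp_polyB comp_polyX rmorph1 subKr comp_polyXr coef_desc_poly.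
Qed.

Lemma refl_coefD c c' i :
  refl_coef (fun j => c j + c' j) i = refl_coef c i + refl_coef c' i.
Proof.
rewrite /refl_coef -mulrDr -big_split /=; congr (_ * _).
by apply: eq_bigr => j _; rewrite mulrDl.
Qed.

Lemma refl_sym_coef c i : (i <= n)%N -> refl_coef (sym_coef c) i = sym_coef c i.
Proof. by move=> lin; rewrite /sym_coef refl_coefD refl_coefK // addrC. Qed.

End Reflection.

(** * The characteristic polynomial of J - 2 B *)

Section CharCoef.
Local Open Scope ring_scope.

Lemma coef_comp_scaleX (R : comNzRingType) (p : {poly R}) a k :
  (p \Po (a *: 'X))`_k = a ^+ k * p`_k.
Proof.
elim/poly_ind: p k => [|p c IH] k; first by rewrite comp_poly0 !coef0 mulr0.
rewrite comp_poly_MXaddC -scalerAr !coefD coefZ !coefMX !coefC IH.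
by case: k => [|k] /=; rewrite ?exprS; ring.
Qed.

(** The function det (2 (x I + B) + s J) is affine in s, so its value at s = -1, which is det (2 x I
    - M), is the mean of those at s = 0 and s = -2. At s = -2, B - J = - I - B^T yields the
    reflected polynomial. *)
Lemma char_poly_pm1 n (B : 'M[int]_n) : tournament_mx B ->
  2%:R *: (char_poly (const_mx 1 - 2%:R *: B) \Po (2%:R *: 'X)) =
  2%:R ^+ n *: (char_poly (- B) + (-1) ^+ n *: (char_poly (- B) \Po (1 - 'X))).
Proof.
move=> [hB eB]; set p := char_poly (- B); set M := const_mx 1 - _.
pose Bp := map_mx polyC B.
have [b Hb] := det_addJ_affine (2%:R *: ('X%:M + Bp)).
have E0 : \det (2%:R *: ('X%:M + Bp)) = 2%:R ^+ n * p.
  rewrite detZ; congr (_ * \det _).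
  by rewrite /char_poly_mx map_mxN opprK.
have E1 : char_poly M \Po (2%:R *: 'X) = 2%:R ^+ n * p - b.
  rewrite -E0 -[b]mul1r -mulNr -Hb -[LHS]/(comp_poly _ _) -det_map_mx.
  congr (\det _); apply/matrixP => i j; rewrite !mxE [LHS]rmorphB rmorphMn /=.
  rewrite comp_polyX comp_polyC !polyCB polyCM polyC1 -mul_polyC polyC_natr.
  by rewrite -mulr_natr -[in RHS]mulr_natr; ring.
have E2 : 2%:R ^+ n * ((-1) ^+ n *: (p \Po (1 - 'X))) = 2%:R ^+ n * p - 2%:R * b.
  rewrite -E0 -mulNr -Hb.
  have -> : p \Po (1 - 'X) = \det ((1 - 'X)%:M + Bp).
    rewrite -[LHS]/(comp_poly _ _) -det_map_mx; congr (\det _).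
    apply/matrixP => i j; rewrite !mxE [LHS]rmorphB rmorphMn /= comp_polyX comp_polyC.
    by rewrite polyCN opprK.
  rewrite -mul_polyC polyC_exp polyCN polyC1 -!detZ -det_tr; congr (\det _).
  apply/matrixP => i j; rewrite !mxE eq_sym.
  move/matrixP: eB => /(_ i j); rewrite !mxE => /eqP; rewrite eq_sym -subr_eq => /eqP <-.
  rewrite !polyCB polyC1 polyC_natr -mulr_natr -[in RHS]mulr_natr.
  ring.
rewrite E1 -[LHS]mul_polyC -[RHS]mul_polyC polyC_exp polyC_natr [RHS]mulrDr E2; ring.
Qed.

Lemma char_coef_pm1 n (B : 'M[int]_n) i : tournament_mx B -> (0 < i <= n)%N ->
  char_coef (const_mx 1 - 2%:R *: B) i =
  2%:R ^+ i.-1 * sym_coef n (fun j => (cycle_poly B)`_j) i.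
Proof.
move=> tB /andP[i0 lin]; rewrite /char_coef lin.
have := congr1 (fun f : {poly int} => f`_(n - i)) (char_poly_pm1 tB).
rewrite !coefZ coef_comp_scaleX coefD.
have Ep : char_poly (- B) = desc_poly n (fun j => (cycle_poly B)`_j).
  rewrite -[LHS](@desc_polyK n) ?size_char_poly //; apply: desc_poly_eq => j jn.
  by rewrite coef_cycle_poly.
rewrite Ep -desc_poly_refl -coefD ?coefD !coef_desc_poly // => E.
apply: (@mulfI _ (2%:R ^+ (n - i).+1)); first by rewrite expf_eq0.
by rewrite [in LHS]exprS -mulrA E mulrA -exprD /sym_coef; congr (_ ^+ _ * _); lia.
Qed.
End CharCoef.

(** * Relations among the z_i modulo powers of 2 *)

Section Arithmetic.
Local Open Scope ring_scope.
Implicit Types (c : nat -> int) (i j k : nat).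

Lemma sym_coefB n c c' i :
  sym_coef n (fun j => c j - c' j) i = sym_coef n c i - sym_coef n c' i.
Proof.
rewrite /sym_coef /refl_coef opprD addrACA -mulrBr -sumrB; congr (_ + _ * _).
by apply: eq_bigr => j _; rewrite mulrBl.
Qed.

Lemma dvdz_sym_coef n c i (d : int) : (forall j, (j <= i)%N -> (d %| c j)%Z) ->
  (d %| sym_coef n c i)%Z.
Proof.
move=> H; rewrite rpredD ?H // dvdz_mull // rpred_sum // => j _.
by rewrite dvdz_mulr // H // -ltnS.
Qed.

Lemma eq_sym_coef0 n c i : (forall j, (j <= i)%N -> c j = 0) -> sym_coef n c i = 0.
Proof. by move=> H; apply/eqP; rewrite -dvd0z; apply: dvdz_sym_coef => j /H ->. Qed.

Lemma sym_coef_odd n c i : odd i -> (forall j, (j < i)%N -> c j = 0) ->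
  sym_coef n c i = 0.
Proof.
move=> oi H; rewrite /sym_coef /refl_coef big_ord_recr /= subnn bin0 mulr1.
rewrite big1 ?add0r; last by move=> j _; rewrite H ?mul0r.
by rewrite -signr_odd oi expr1 mulN1r subrr.
Qed.

Lemma sym_coef_even n c i : ~~ odd i -> (forall j, (j <= i)%N -> c j = 0) ->
  sym_coef n c i.+2 = 2%:R * c i.+2 + (n - i.+1)%:R * c i.+1.
Proof.
move=> oi H; rewrite /sym_coef /refl_coef !big_ord_recr /= subnn bin0 mulr1.
rewrite big1; last by move=> j _; rewrite H ?mul0r // ltnW.
rewrite (H i) // mul0r !add0r subSnn bin1 -signr_odd /= negbK (negPf oi) expr0; ring.
Qed.

(** The z's are fixed by the reflection, whose i-th coefficient contains - z_i when i is odd. *)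
Lemma sym_coef_odd_rec n c i : odd i -> (i <= n)%N ->
  2%:R * sym_coef n c i = - \sum_(j < i) sym_coef n c j * 'C(n - j, i - j)%:R.
Proof.
move=> oi lin; have := refl_sym_coef c lin; rewrite {1}/refl_coef big_ord_recr /=.
rewrite subnn bin0 mulr1 -signr_odd oi expr1 mulN1r.
by set S := \sum_(_ < _) _; move: S (sym_coef n c i) => S s; lia.
Qed.

(** The required power of 2 drops by one per index, which pays for the factor 2 in
    [sym_coef_odd_rec]. Odd indices thus add no condition. *)
Lemma dvdz_sym_coef_odd n e c i : odd i -> (i <= n)%N -> (i <= e)%N ->
  (forall j, (j < i)%N -> (2%:R ^+ (e.+1 - j) %| sym_coef n c j)%Z) ->
  (2%:R ^+ (e.+1 - i) %| sym_coef n c i)%Z.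
Proof.
move=> oi lin lie H.
rewrite -(@dvdz_mul2l 2%:R) // -exprS (sym_coef_odd_rec c oi lin) rpredN.
apply: rpred_sum => j _; rewrite dvdz_mulr //; apply: dvdz_trans (H j _) => //.
by apply: dvdz_exp2l; have := ltn_ord j; lia.
Qed.

(* For odd [n] the relation at the odd index [i.+1] has the odd coefficient
   [n - i] at [sym_coef n c i]. *)
Lemma dvdz2_sym_coef n c i : odd n -> ~~ odd i -> (i < n)%N ->
  (forall j, (j < i)%N -> (2%:R %| sym_coef n c j)%Z) ->
  (2%:R %| sym_coef n c i)%Z.
Proof.
move=> on oi lin H; have oSi : odd i.+1 by [].
have := sym_coef_odd_rec c oSi lin; rewrite big_ord_recr /= subSnn bin1.
set S := \sum_(_ < _) _ => E.
have dS : (2%:R %| S)%Z by apply: rpred_sum => j _; rewrite dvdz_mulr // H.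
have : (2%:R %| sym_coef n c i * (n - i)%:R)%Z.
  have -> : sym_coef n c i * (n - i)%:R = - S - 2%:R * sym_coef n c i.+1.
    by rewrite E; ring.
  by rewrite rpredB ?rpredN // dvdz_mulr.
have -> : (n - i = (n - i)./2.*2.+1)%N.
  by rewrite -[LHS]odd_double_half oddB ?(ltnW lin) // on (negPf oi).
rewrite -natr1 mulrDr mulr1 rpredDl //.
by rewrite dvdz_mull // -muln2 natrM dvdz_mull.
Qed.

(* The parameter [w k] enters the coefficients of index [2 k + 3] and [2 k + 4];
   the weights make it change [sym_coef] at [2 k + 4], and at no smaller index, by
   [w k] when [n] is even and by [2 * w k] when [n] is odd. *)
Definition param_weight n j : int :=
  if odd n then (~~ odd j)%:R else if odd j then 1 else - ((n - j)./2)%:R.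

Definition param_coef n (w : nat -> int) j : int :=
  if j is 0 then 1 else if (j < 3)%N then 0 else w ((j - 3)./2) * param_weight n j.

Lemma sym_coef_param n w w' k : (k.*2 + 4 <= n)%N ->
  (forall l, (l < k)%N -> w l = w' l) ->
  [/\ forall i, (i < k.*2 + 4)%N ->
        sym_coef n (fun j => param_coef n w j - param_coef n w' j) i = 0
    & sym_coef n (fun j => param_coef n w j - param_coef n w' j) (k.*2 + 4) =
      2%:R ^+ odd n * (w k - w' k)].
Proof.
move=> kn H; set d := fun j => _.
have d0 j : (j < k.*2 + 3)%N -> d j = 0.
  rewrite /d /param_coef; case: j => [|j] jk; first by rewrite subrr.
  by case: ifP => [_|/negbT j3]; [rewrite subrr | rewrite H ?subrr //; lia].
have oS : odd (k.*2 + 3) by rewrite oddD odd_double.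
split=> [i|].
  rewrite addnS ltnS leq_eqVlt => /orP[/eqP->|ik].
    exact: sym_coef_odd.
  by apply: eq_sym_coef0 => j ji; apply: d0; apply: leq_ltn_trans ik.
have -> : (k.*2 + 4 = (k.*2 + 2).+2)%N by lia.
rewrite sym_coef_even; first last.
- by move=> j jk; apply: d0; lia.
- by rewrite oddD odd_double.
have E3 : d (k.*2 + 2).+1 = (w k - w' k) * param_weight n (k.*2 + 2).+1.
  rewrite /d /param_coef.
  have -> : ((k.*2 + 2).+1 < 3)%N = false by lia.
  have -> : (((k.*2 + 2).+1 - 3)./2 = k)%N by lia.
  by rewrite mulrBl.
have E4 : d (k.*2 + 2).+2 = (w k - w' k) * param_weight n (k.*2 + 2).+2.
  rewrite /d /param_coef.
  have -> : ((k.*2 + 2).+2 < 3)%N = false by lia.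
  have -> : (((k.*2 + 2).+2 - 3)./2 = k)%N by lia.
  by rewrite mulrBl.
rewrite E3 E4 /param_weight /= negbK oddD odd_double /=.
(* For odd [n] only the even index has a weight, and 2 * 1 = 2. For even [n], with h as below, 2 (-
   h) + (2 h + 1) = 1. *)
case: (boolP (odd n)) => on /=; first by rewrite expr1; ring.
have -> : (n - (k.*2 + 2).+1 = ((n - (k.*2 + 2).+2)./2).*2.+1)%N.
  have := odd_double_half (n - (k.*2 + 2).+2); rewrite oddB; last lia.
  by rewrite (negPf on) /= negbK oddD odd_double /=; lia.
set h := (n - _)./2; rewrite -[h.*2.+1%:R]natr1 -[h.*2]muln2 natrM; ring.
Qed.

(** The system is triangular: [w k] is chosen to correct index 2 k + 4, and odd indices follow. For
    odd [n] the parameter acts through 2 * w k, hence has one bit less. *)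
Lemma param_surjective n e c : (e < n)%N -> c 0%N = 1 -> c 1%N = 0 -> c 2%N = 0 ->
  exists w : nat -> int,
  [/\ forall k, 0 <= w k < 2%:R ^+ (e - (k.*2 + 4) + ~~ odd n),
      forall k, ((e - 2)./2 <= k)%N -> w k = 0
    & forall i, (i <= e)%N ->
        (2%:R ^+ (e.+1 - i) %| sym_coef n (fun j => c j - param_coef n w j) i)%Z].
Proof.
move=> en c0 c1 c2.
suff [w [H1 H2 H3]] : exists w : nat -> int,
  [/\ forall k, 0 <= w k < 2%:R ^+ (e - (k.*2 + 4) + ~~ odd n),
      forall k, ((e - 2)./2 <= k)%N -> w k = 0
    & forall i, (i <= e)%N -> (i < (e - 2)./2.*2 + 4)%N ->
        (2%:R ^+ (e.+1 - i) %| sym_coef n (fun j => c j - param_coef n w j) i)%Z].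
  by exists w; split=> // i ie; apply: H3 => //; lia.
(* The number of parameters becomes a variable bounded by (e - 2)./2, ready for induction. *)
have [r Er] : exists r, r = (e - 2)./2 by exists (e - 2)./2.
have re := leqnn r; rewrite {2}Er in re; rewrite -Er => {Er}.
elim: r re => [|m IH] mr.
  exists (fun=> 0); split=> // [k|i ie i4]; first by rewrite lexx exprn_gt0.
  set d := fun j => _.
  have d0 j : (j < 3)%N -> d j = 0.
    by case: j => [|[|[|j]]] // _; rewrite /d /param_coef /= ?c0 ?c1 ?c2 subrr.
  have [i3|i3] := ltnP i 3.
    by rewrite eq_sym_coef0 // => j ji; apply: d0; apply: leq_ltn_trans i3.
  have -> : i = 3%N by lia.
  by rewrite sym_coef_odd.
have [w [H1 H2 H3]] := IH (ltnW mr).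
have me : (m.*2 + 4 <= e)%N by lia.
pose s := sym_coef n (fun j => c j - param_coef n w j) (m.*2 + 4).
(* For odd [n] the error [s] is even, its parity being forced by the smaller indices. *)
have [q Eq] : exists q, s = 2%:R ^+ odd n * q.
  case: (boolP (odd n)) => on; last by exists s; rewrite expr0 mul1r.
  suff /dvdzP[q ->] : (2%:R %| s)%Z by exists q; rewrite mulrC.
  apply: dvdz2_sym_coef => // [||j jm]; rewrite ?oddD ?odd_double //; first lia.
  apply: dvdz_trans (H3 j _ _) => //; last lia.
  by have -> : (e.+1 - j = (e - j).+1)%N; [lia | rewrite exprS dvdz_mulr].
pose M : int := 2%:R ^+ (e - (m.*2 + 4) + ~~ odd n).
have M0 : 0 < M by rewrite exprn_gt0.
(* As [w m] is 0, the new error at 2 m + 4 is 2^(odd n) (q - q mod M), and 2^(odd n) M is the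
   required modulus. *)
pose w' k := if k == m then (q %% M)%Z else w k.
exists w'; split=> [k|k mk|].
- rewrite /w'; case: eqP => [->|_]; last exact: H1.
  by rewrite modz_ge0 ?gt_eqF //= ltz_pmod.
- by rewrite /w' gtn_eqF // H2 // ltnW.
have [|P1 P2] := @sym_coef_param n w' w m (leq_trans me (ltnW en)).
  by move=> l lm; rewrite /w' ltn_eqF.
have E i : sym_coef n (fun j => c j - param_coef n w' j) i =
   sym_coef n (fun j => c j - param_coef n w j) i
   - sym_coef n (fun j => param_coef n w' j - param_coef n w j) i.
  by rewrite !sym_coefB; ring.
have P3 i : (i <= e)%N -> (i <= m.*2 + 4)%N ->
    (2%:R ^+ (e.+1 - i) %| sym_coef n (fun j => c j - param_coef n w' j) i)%Z.
  move=> ie; rewrite leq_eqVlt => /orP[/eqP->|im]; last by rewrite E P1 // subr0 H3.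
  rewrite E P2 -/s Eq -mulrBr H2 // subr0 /w' eqxx.
  have -> : (e.+1 - (m.*2 + 4) = odd n + (e - (m.*2 + 4) + ~~ odd n))%N by case: odd; lia.
  rewrite exprD dvdz_mul //; apply/dvdzP; exists (q %/ M)%Z.
  by rewrite {1}(divz_eq q M) addrK.
move=> i ie im; have [im4|im4] := leqP i (m.*2 + 4); first exact: P3.
have {im im4} Ei : i = (m.*2 + 4).+1 by lia.
apply: dvdz_sym_coef_odd => //; first by rewrite Ei /= oddD odd_double.
  by apply: leq_trans ie (ltnW en).
by move=> j ji; apply: P3; lia.
Qed.

(** Once the smaller parameters agree, index 2 k + 4 determines [w k] modulo the length of its
    range. *)
Lemma param_injective n e (w w' : nat -> int) : (e < n)%N ->
  (forall k, 0 <= w k < 2%:R ^+ (e - (k.*2 + 4) + ~~ odd n)) ->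
  (forall k, 0 <= w' k < 2%:R ^+ (e - (k.*2 + 4) + ~~ odd n)) ->
  (forall i, (1 < i <= e)%N -> (2%:R ^+ (e.+1 - i) %|
     sym_coef n (fun j => param_coef n w j - param_coef n w' j) i)%Z) ->
  forall k, (k.*2 + 4 <= e)%N -> w k = w' k.
Proof.
move=> en Hw Hw' H; elim/ltn_ind => k IH ke.
have [|_ E] := @sym_coef_param n w w' k (leq_trans ke (ltnW en)).
  by move=> l lk; apply: IH => //; lia.
have := H (k.*2 + 4)%N; rewrite E.
have -> : (e.+1 - (k.*2 + 4) = odd n + (e - (k.*2 + 4) + ~~ odd n))%N by case: odd; lia.
rewrite exprD dvdz_mul2l ?expf_neq0 // => D.
have {D} : (2%:R ^+ (e - (k.*2 + 4) + ~~ odd n) %| w k - w' k)%Z by apply: D; lia.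
rewrite -eqz_mod_dvd; move: (Hw k) (Hw' k) => /andP[a0 a1] /andP[b0 b1].
by rewrite !modz_small ?a0 ?a1 ?b0 ?b1 // => /eqP.
Qed.

End Arithmetic.

(** * Counting the classes *)

Section Counting.
Local Open Scope ring_scope.

Lemma tournament_of_skew n (M : 'M[int]_n) : skew_tournament_mx M ->
  exists2 B, tournament_mx B & M = const_mx 1 - 2%:R *: B.
Proof.
move=> [pm1 diag skew]; pose B : 'M[int]_n := \matrix_(i, j) (M i j != 1)%:R.
have EM : M = const_mx 1 - 2%:R *: B.
  by apply/matrixP => i j; rewrite !mxE; case: (pm1 i j) => ->.
exists B => //; split=> [i j|]; first by rewrite mxE; case: eqP; [left|right].
apply/matrixP => i j; move/matrixP: skew => /(_ i j).
rewrite !mxE [j == i]eq_sym; case: (eqVneq i j) => [<-|_]; first by rewrite diag.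
by case: (pm1 i j) => ->; case: (pm1 j i) => ->.
Qed.

Lemma skew_of_tournament n (B : 'M[int]_n) : tournament_mx B ->
  skew_tournament_mx (const_mx 1 - 2%:R *: B).
Proof.
move=> tB; have [hB eB] := tB; split=> [i j|i|].
- by rewrite !mxE; case: (hB i j) => ->; [left|right].
- by rewrite !mxE tournament_diag // mulr0 subr0.
apply/matrixP => i j; rewrite !mxE [j == i]eq_sym.
move/matrixP: eB => /(_ i j); rewrite !mxE.
by case: (hB i j) => ->; case: (hB j i) => ->; case: (i == j).
Qed.

Definition sym_classes e n (c : nat -> int) : (e.-1).-tuple 'Z_(2 ^ e) :=
  [tuple (2%:R ^+ k.+1 * sym_coef n c k.+2)%:~R | k < e.-1].

Lemma char_coef_classesE e n (B : 'M[int]_n) : (e <= n)%N -> tournament_mx B ->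
  char_coef_classes e (const_mx 1 - 2%:R *: B) =
  sym_classes e n (fun j => (cycle_poly B)`_j).
Proof.
move=> en tB; apply: eq_from_tnth => k; rewrite !tnth_mktuple char_coef_pm1 //.
by have := ltn_ord k; lia.
Qed.

Lemma eq_sym_classes e n c c' : (0 < e)%N ->
  sym_classes e n c = sym_classes e n c' <->
  (forall i, (1 < i <= e)%N ->
    (2%:R ^+ (e.+1 - i) %| sym_coef n (fun j => c j - c' j) i)%Z).
Proof.
move=> e0; have P1 : (1 < 2 ^ e)%N by rewrite -{1}(expn0 2) ltn_exp2l.
have E k : (k < e.-1)%N ->
  ((2%:R ^+ k.+1 * sym_coef n c k.+2)%:~R =
   (2%:R ^+ k.+1 * sym_coef n c' k.+2)%:~R :> 'Z_(2 ^ e))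
  <-> (2%:R ^+ (e.+1 - k.+2) %| sym_coef n (fun j => c j - c' j) k.+2)%Z.
  move=> ke; rewrite (intr_Zp_eq _ _ P1) -mulrBr -sym_coefB.
  have -> : Posz (2 ^ e) = 2%:R ^+ k.+1 * 2%:R ^+ (e.+1 - k.+2).
    by rewrite -exprD -natrX natz; congr (Posz (2 ^ _)); lia.
  by rewrite dvdz_mul2l ?expf_neq0.
split=> [Et [|[|k]] //= ke|H].
  have ke' : (k < e.-1)%N by lia.
  apply/(E k ke').
  by have := congr1 (fun t => tnth t (Ordinal ke')) Et; rewrite !tnth_mktuple.
apply: eq_from_tnth => k; rewrite !tnth_mktuple.
by apply/(E _ (ltn_ord k))/H; have := ltn_ord k; lia.
Qed.

(** The total number of parameter bits, for e = 2 r + 2 + s. Removing the first parameter gives the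
    same sum for r - 1. *)
Lemma sum_param_bits r (s b : nat) :
  (\sum_(k < r) (r.*2 + 2 + s - (k.*2 + 4) + b) = r * (r.-1 + s + b))%N.
Proof.
elim: r => [|r IH]; first by rewrite big_ord0.
rewrite big_ord_recl /=.
rewrite (eq_bigr (fun k : 'I_r => (r.*2 + 2 + s - (k.*2 + 4) + b)%N)) => [|k _].
  by rewrite IH; case: r {IH} => [|r]; nia.
by rewrite /bump /=; lia.
Qed.

(** The bound depends on k, so all parameters share the codomain ['I_(2 ^ e)]; [b] says that n is
    even. *)
Definition param_range e (b : bool) : {set {ffun 'I_((e - 2)./2) -> 'I_(2 ^ e)}} :=
  [set f in family (fun k : 'I__ => [pred v : 'I_(2 ^ e) |
    (v < 2 ^ (e - (k.*2 + 4) + b))%N])].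

Lemma card_param_range e (b : bool) : (3 <= e)%N ->
  #|param_range e b| =
  (2 ^ ((e - 2)./2 * (if b then (e - 1)./2 else (e - 3)./2)))%N.
Proof.
move=> e3; rewrite cardsE card_family foldrE big_map big_enum /=.
under eq_bigr => k _.
  rewrite -sum1_card -(big_ord_widen _ (fun=> 1%N)); last first.
    by rewrite leq_exp2l //; case: b; lia.
  rewrite sum1_card card_ord; over.
rewrite -expn_sum; congr (2 ^ _)%N.
have Ee : e = ((e - 2)./2.*2 + 2 + odd e)%N.
  by have := odd_double_half (e - 2); rewrite oddB //=; [|lia]; rewrite addbF; lia.
set r := (e - 2)./2 in Ee *; rewrite [in LHS]Ee sum_param_bits.
case: (posnP r) => [->|r0]; first by rewrite !mul0n.
by congr (_ * _)%N; case: b; rewrite Ee; case: (odd e) => /=; lia.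
Qed.

Definition range_param e (f : {ffun 'I_((e - 2)./2) -> 'I_(2 ^ e)}) k : int :=
  if insub k is Some k' then Posz (f k') else 0.

Lemma range_paramP e b f : f \in param_range e b -> forall k,
  0 <= range_param f k < 2%:R ^+ (e - (k.*2 + 4) + b).
Proof.
rewrite inE => /familyP H k; rewrite /range_param.
case: insubP => [k' _ <-|_]; last by rewrite lexx exprn_gt0.
by have := H k'; rewrite inE -natrX natz.
Qed.

Lemma congruence_classesE e n : (3 <= e)%N -> (e < n)%N ->
  (forall x : nat -> int, x 0%N = 1 -> x 1%N = 0 -> x 2%N = 0 ->
    exists2 B : 'M[int]_n, tournament_mx B &
    forall i, (i <= e)%N -> ((2 ^ e)%N %| (cycle_poly B)`_i - x i)%Z) ->
  congruence_classes e (@skew_tournament_mx n) =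
  [set sym_classes e n (param_coef n (range_param f)) | f in param_range e (~~ odd n)].
Proof.
move=> e3 en real; have e0 : (0 < e)%N by apply: leq_trans e3.
apply/setP => t; rewrite inE; apply/asboolP/imsetP => [[M [sM <-]]|[f Hf ->]].
  have [B tB ->] := tournament_of_skew sM.
  rewrite char_coef_classesE ?(ltnW en) //.
  have [g Eg] := cycle_poly_low tB.
  have [||| w [w1 w2 w3]] := @param_surjective n e (fun j => (cycle_poly B)`_j) en;
    rewrite ?Eg ?coefD ?coefXnM ?coef1 ?addr0 //.
  have we k : (`|w k| < 2 ^ e)%N.
    have := w1 k; rewrite -natrX natz => /andP[w0 wl].
    have [kr|kr] := leqP (e - 2)./2 k; first by rewrite w2 // expn_gt0.
    have : (`|w k| < 2 ^ (e - (k.*2 + 4) + ~~ odd n))%N by lia.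
    by move/leq_trans; apply; rewrite leq_exp2l //; case: odd; lia.
  exists [ffun k : 'I_((e - 2)./2) => Ordinal (we k)].
    rewrite inE; apply/familyP => k; rewrite inE ffunE /=.
    by have := w1 k; rewrite -natrX natz; lia.
  apply/eq_sym_classes => // i /andP[_ ie].
  (* Beyond the range [w] vanishes, in agreement with the default value of [range_param]. *)
  rewrite (_ : range_param _ = w) -?Eg; first exact: w3.
  apply/funext => k; rewrite /range_param.
  case: insubP => [k' _ <-|]; last by rewrite -leqNgt => /w2.
  by rewrite ffunE /=; have := w1 k'; lia.
have [//|//|//|B tB HB] := real (param_coef n (range_param f)).
exists (const_mx 1 - 2%:R *: B); split; first exact: skew_of_tournament.
rewrite char_coef_classesE ?(ltnW en) //; apply/eq_sym_classes => // i ie.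
apply: dvdz_trans (dvdz_sym_coef (d := Posz (2 ^ e)) _ _) => [|j ji].
  by rewrite -natz natrX dvdz_exp2l //; lia.
by apply: HB; lia.
Qed.

Lemma range_param_inj e n : (3 <= e)%N -> (e < n)%N ->
  {in param_range e (~~ odd n) &, injective (fun f =>
     sym_classes e n (param_coef n (range_param f)))}.
Proof.
move=> e3 en f f' Hf Hf' /eq_sym_classes; rewrite (leq_trans _ e3) // => /(_ isT) H.
apply/ffunP => k; apply/val_inj/eqP; rewrite -eqz_nat; apply/eqP.
have := param_injective en (range_paramP Hf) (range_paramP Hf') H.
move/(_ k); rewrite /range_param valK; apply.
by have := ltn_ord k; lia.
Qed.
End Counting.

Theorem theorem1p4 (e : nat) (he : 3 <= e) :
  exists N : nat, forall n : nat, N < n ->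
    #|congruence_classes e (@skew_tournament_mx n)| =
      if odd n then 2 ^ (((e - 2) %/ 2) * ((e - 3) %/ 2))
      else 2 ^ (((e - 1) %/ 2) * ((e - 2) %/ 2)).
Proof.
have [N HN] := realization_bound (leq_trans (isT : 0 < 3) he).
(* Besides realization, e < n ensures that every index up to e occurs in the characteristic
   polynomial. *)
exists (maxn N e) => n; rewrite gtn_max => /andP[Nn en].
rewrite (congruence_classesE he en (HN n Nn)) card_in_imset; last exact: range_param_inj.
by rewrite card_param_range // !divn2; case: (odd n) => //=; rewrite mulnC.
Qed.
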